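(* Consider PRIS-ARIS-NOMA with perfect successive interference cancellation (pSIC) (model in the context), and define the ergodic data rate slope by $$S=\lim_{P_s^a\to\infty}\frac{R^{ergodic,\infty}(P_s^a)}{\log P_s^a},$$ where $R^{ergodic,\infty}(P_s^a)$ denotes the asymptotic ergodic data rate at high SNR. Substituting for $R^{ergodic,\infty}$ the Jensen upper bound of the ergodic data rate of the nearby user $D_n$ with pSIC as $P_s^a\to\infty$, $$R_{D_n,pSIC}^{ergodic,up}=\log_2\left[1+\mathbb{E}(\gamma_{D_n})\right]=\log_2\left[1+\frac{\vartheta_n\beta P_s^aa_n\left(\overline{\lambda_n}\right)^{-1}}{\beta\sigma_a^2M\Omega_{na}+\sigma^2}\right],$$ one obtains that the ergodic data rate slope for $D_n$ with pSIC is equal to $1$, i.e. $$S=\lim_{P_s^a\to\infty}\frac{R_{D_n,pSIC}^{ergodic,up}(P_s^a)}{\log_2P_s^a}=1.$$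
   Context: Model (PRIS-ARIS-NOMA). A base station with transmit power $P_s^a$ serves a nearby user $D_n$ and a distant user $D_m$ by non-orthogonal multiple access (NOMA) over the chain: base station, passive reconfigurable intelligent surface (PRIS) with $N$ reflecting elements, amplify-and-forward relay (gain 1), active reconfigurable intelligent surface (ARIS) with $M$ reflecting elements and amplification factor $\beta>1$, users. Power allocation factors $a_n,a_m$ satisfy $a_n+a_m=1$. The channel vectors are $\mathbf h_1=\sqrt{\eta d_{h1}^{-\alpha}}[h_1^1,\dots,h_N^1]^H$ (base station to PRIS), $\mathbf h_2=\sqrt{\eta d_{h2}^{-\alpha}}[h_1^2,\dots,h_N^2]^H$ (PRIS to relay), $\mathbf g_1=\sqrt{\eta d_{g1}^{-\alpha}}[g_1^1,\dots,g_M^1]^H$ (relay to ARIS), $\mathbf g_n=\sqrt{\eta d_{gn}^{-\alpha}}[g_1^n,\dots,g_M^n]^H$ (ARIS to user $D_n$), with path loss $\eta$, path loss exponent $\alpha$ and distances $d_{h1},d_{h2},d_{g1},d_{gn}$. All coefficients are independent; $h_i^1$ and $g_j^n$ follow Nakagami-$m$ fading with shape parameter $m_{na}$ and scale parameter $\Omega_{na}$; $h_i^2$ and $g_j^1$ are Rician, each of the form $\sqrt{\kappa/(\kappa+1)}+\sqrt{1/(\kappa+1)}\,w$ with $w\sim\mathcal{CN}(0,1)$ and Rician factor $\kappa$. $\mathbf\Phi_p$ and $\mathbf\Phi_a$ are the diagonal unit-modulus phase shift matrices of the PRIS and the ARIS. Coherent phase shifting is used, so that, up to the path-loss factors, $|\mathbf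 h_2^H\mathbf\Phi_p\mathbf h_1|^2$ equals $\left(\sum_{i=1}^N|h_i^1h_i^2|\right)^2$ and $|\mathbf g_n^H\mathbf\Phi_a\mathbf g_1|^2$ equals $\left(\sum_{j=1}^M|g_j^1g_j^n|\right)^2$. $\sigma_a^2$ is the ARIS thermal noise power and $\sigma^2$ the receiver noise power. SINR of $D_n$ for its own signal (pSIC): $$\gamma_{D_n}=\frac{\beta P_s^a|\mathbf h_2^H\mathbf\Phi_p\mathbf h_1|^2|\mathbf g_n^H\mathbf\Phi_a\mathbf g_1|^2a_n}{\beta\sigma_a^2\|\mathbf g_n^H\mathbf\Phi_a\|^2+\sigma^2}.$$ The ergodic data rate is $\mathbb{E}[\log_2(1+\gamma_{D_n})]$, and the upper bound comes from Jensen's inequality $\mathbb{E}[\log_2(1+\gamma_{D_n})]\le\log_2[1+\mathbb{E}(\gamma_{D_n})]$. Constants: $\overline{\lambda_n}=\eta^{-4}d_{h1}^{\alpha}d_{h2}^{\alpha}d_{g1}^{\alpha}d_{gn}^{\alpha}$; $\vartheta_n=\left[(Ne_\varphi)^2+Nd_\varphi\right]\left[(Me_\varphi)^2+Md_\varphi\right]$, where $e_\varphi=\sqrt{\frac{\pi}{4(\kappa+1)}}\,\frac{\Gamma(m_{na}+\frac12)}{\Gamma(m_{na})}\,m_{na}^{-1/2}\,L_{1/2}(-\kappa)$ and $d_\varphi=1-\frac{L_{1/2}^2(-\kappa)}{4(\kappa+1)}\cdot\frac{\pi}{m_{na}}\left(\frac{\Gamma(m_{na}+\frac12)}{\Gamma(m_{na})}\right)^2$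 are the mean and variance of $|h_i^1h_i^2|$ and of $|g_j^1g_j^n|$, with $L_{1/2}(-\kappa)=e^{-\kappa/2}[(1+\kappa)I_0(\kappa/2)+\kappa I_1(\kappa/2)]$ and $I_0,I_1$ modified Bessel functions of the first kind.
   Formalization: The middle equality log2[1+E(γ)] = log2[1+closed form] is not asserted, since it is false (the mean of a ratio is replaced by a ratio of means); instead, slope 1 is proved separately for log2[1+E(γ)] with the true expectation and for the closed form. *)

(* Defs.v *)
From HB Require Import structures.
From mathcomp Require Import all_boot all_order all_algebra.
From mathcomp Require Import all_classical all_reals all_analysis.
From mathcomp Require Import complex.

Set Implicit Arguments.
Unset Strict Implicit.
Unset Printing Implicit Defensive.

Import Order.TTheory GRing.Theory Num.Theory.
Import numFieldNormedType.Exports.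

Local Open Scope classical_set_scope.
Local Open Scope ring_scope.
Local Open Scope complex_scope.

Definition log2 {R : realType} (x : R) : R := ln x / ln 2.

Definition Gamma {R : realType} (x : R) : R :=
  \int[lebesgue_measure]_(t in `]0, +oo[) (t `^ (x - 1) * expR (- t)).

(* Modified Bessel function of the first kind, of integer order nu. *)
Definition besselI {R : realType} (nu : nat) (x : R) : R :=
  limn (series (fun k : nat =>
    (x / 2) ^+ (2 * k + nu) / (k`! * (k + nu)`!)%:R)).

(* L_{1/2}(- kappa), the argument being kappa and not - kappa. *)
Definition laguerre_half_opp {R : realType} (kappa : R) : R :=
  expR (- kappa / 2) *
  ((1 + kappa) * besselI 0 (kappa / 2) + kappa * besselI 1 (kappa / 2)).

Definition e_phi {R : realType} (m kappa : R) : R :=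
  Num.sqrt (pi / (4 * (kappa + 1))) * (Gamma (m + 2^-1) / Gamma m) *
  m `^ (- 2^-1) * laguerre_half_opp kappa.

Definition d_phi {R : realType} (m kappa : R) : R :=
  1 - laguerre_half_opp kappa ^+ 2 / (4 * (kappa + 1)) * (pi / m) *
      (Gamma (m + 2^-1) / Gamma m) ^+ 2.

Definition theta {R : realType} (N M : nat) (m kappa : R) : R :=
  ((N%:R * e_phi m kappa) ^+ 2 + N%:R * d_phi m kappa) *
  ((M%:R * e_phi m kappa) ^+ 2 + M%:R * d_phi m kappa).

Definition lambda_bar {R : realType} (eta alpha dh1 dh2 dg1 dgn : R) : R :=
  eta ^- 4 * dh1 `^ alpha * dh2 `^ alpha * dg1 `^ alpha * dgn `^ alpha.

Definition cabs {R : realType} (z : R[i]) : R := complex.Re `|z|.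

Definition ctr {R : realType} (m n : nat) (A : 'M[R[i]]_(m, n)) :
  'M[R[i]]_(n, m) := (map_mx conjc A)^T.

Definition sqnorm {R : realType} (n : nat) (v : 'rV[R[i]]_n) : R :=
  \sum_(i < n) cabs (v 0 i) ^+ 2.

Definition phase_shift {R : realType} (n : nat) (Phi : 'M[R[i]]_n) : Prop :=
  is_diag_mx Phi /\ forall i, cabs (Phi i i) = 1.

Definition path_loss {R : realType} (eta alpha dist : R) : R :=
  eta * dist `^ (- alpha).

(* sqrt(pl) [c_1, ..., c_n]^H *)
Definition chan {R : realType} (n : nat) (pl : R) (c : 'I_n -> R[i]) :
  'cV[R[i]]_n := (Num.sqrt pl)%:C *: ctr (\row_i c i).

(* x^H Phi y for column vectors x and y *)
Definition cascade {R : realType} (n : nat) (x : 'cV[R[i]]_n)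
  (Phi : 'M[R[i]]_n) (y : 'cV[R[i]]_n) : R[i] := (ctr x *m Phi *m y) 0 0.

(* SINR of the nearby user for its own signal, perfect SIC. *)
Definition sinr {R : realType} (N M : nat) (beta a_n sigmaa sigma : R)
  (h1 h2 : 'cV[R[i]]_N) (g1 gn : 'cV[R[i]]_M)
  (Phip : 'M[R[i]]_N) (Phia : 'M[R[i]]_M) (Ps : R) : R :=
  (beta * Ps * cabs (cascade h2 Phip h1) ^+ 2 *
     cabs (cascade gn Phia g1) ^+ 2 * a_n) /
  (beta * sigmaa ^+ 2 * sqnorm (ctr gn *m Phia) + sigma ^+ 2).

Section Probability.
Context {d : measure_display} {T : measurableType d} {R : realType}.
Variable Pr : probability T R.

Definition complex_rv (X : T -> R[i]) : Prop :=
  measurable_fun setT (fun t => complex.Re (X t)) /\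
  measurable_fun setT (fun t => complex.Im (X t)).

(* Mutual independence; Borel sets of the complex plane are those of R * R. *)
Definition mutually_independent (I : finType) (X : I -> T -> R[i]) : Prop :=
  forall (J : {set I}) (A : I -> set (R * R)%type),
    (forall i, measurable (A i)) ->
    fine (Pr [set t | forall i, i \in J ->
                      A i (complex.Re (X i t), complex.Im (X i t))]) =
    \prod_(i in J)
      fine (Pr [set t | A i (complex.Re (X i t), complex.Im (X i t))]).

(* Circularly symmetric CN(0,1): real and imaginary parts are independent
   centred Gaussians of variance 1/2; the second argument of normal_prob is
   the standard deviation. *)
Definition cn01 (w : T -> R[i]) : Prop :=
  complex_rv w /\
  forall A B : set R, measurable A -> measurable B ->
    Pr [set t | A (complex.Re (w t)) /\ B (complex.Im (w t))] =
    (normal_prob 0 (Num.sqrt 2^-1) A * normal_prob 0 (Num.sqrt 2^-1) B)%E.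

Definition rician (kappa : R) (X : T -> R[i]) : Prop :=
  exists2 w : T -> R[i], cn01 w &
    forall t, X t = (Num.sqrt (kappa / (kappa + 1)))%:C +
                    (Num.sqrt (1 / (kappa + 1)))%:C * w t.

Definition nakagami_pdf (m Omega x : R) : R :=
  if 0 < x then
    2 * m `^ m / (Gamma m * Omega `^ m) * x `^ (2 * m - 1) *
    expR (- m / Omega * x ^+ 2)
  else 0.

(* Nakagami-m fading constrains the envelope only; the phase is arbitrary. *)
Definition nakagami (m Omega : R) (X : T -> R[i]) : Prop :=
  complex_rv X /\
  forall A : set R, measurable A ->
    Pr [set t | A (cabs (X t))] =
    (\int[lebesgue_measure]_(x in A) (nakagami_pdf m Omega x)%:E)%E.

(* log2 (1 + E X), Jensen's bound on E[log2 (1 + X)]. *)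
Definition jensen_rate (X : T -> R) : R := log2 (1 + fine ('E_Pr[X])%E).

End Probability.

Definition all_coefs {S : Type} (N M : nat)
  (h1 h2 : 'I_N -> S) (g1 gn : 'I_M -> S)
  (k : ('I_N + 'I_N) + ('I_M + 'I_M)) : S :=
  match k with
  | inl (inl i) => h1 i
  | inl (inr i) => h2 i
  | inr (inl j) => g1 j
  | inr (inr j) => gn j
  end.

(* Closed-form expression of the Jensen bound for the nearby user. It is not
   literally jensen_rate of the sinr: the mean of the ratio is replaced by a
   ratio of means, with M * Omega standing for the mean of the amplified-noise
   gain (no path loss), and theta computed for unit-power Nakagami fading. *)
Definition rate_up {R : realType} (N M : nat)
  (eta alpha dh1 dh2 dg1 dgn beta a_n sigmaa sigma m Omega kappa Ps : R) : R :=
  log2 (1 + theta N M m kappa * beta * Ps * a_n *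
              (lambda_bar eta alpha dh1 dh2 dg1 dgn)^-1 /
            (beta * sigmaa ^+ 2 * M%:R * Omega + sigma ^+ 2)).

(* The ergodic data rate slope of the high-SNR rate Rinf exists and equals S.
   Rate and power are measured with the same logarithm, to base 2. *)
Definition ergodic_slope {R : realType} (Rinf : R -> R) (S : R) : Prop :=
  Rinf Ps / log2 Ps @[Ps --> +oo%R] --> S.

(* Main.v *)
(* The SINR is linear in the transmit power P, so both rates have the form
   log2 (1 + c P) with c independent of P, and the slope is 1 as soon as c is
   positive and finite.

   For the closed form, mean and variance satisfy e_phi ^ 2 + d_phi = 1, hence
   each factor of theta is n + n (n - 1) e_phi ^ 2 > 0. For the SINR itself,
   c = E [gamma_1] is positive because all coefficients are almost surely
   nonzero. It is finite because gamma_1 is at most a constant times the sixth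
   power of the sum of all |h1_i|, |h2_i| and |g1_j|, whose sixth moments are
   finite: Nakagami and Gaussian densities have Gaussian tails. *)

Require Import Defs.
From HB Require Import structures.
From mathcomp Require Import all_boot all_order all_algebra.
From mathcomp Require Import all_classical all_reals all_analysis.
From mathcomp Require Import complex.
From mathcomp Require Import measurable_realfun.
From mathcomp Require Import ring lra.
Import Order.TTheory GRing.Theory Num.Theory.
Import numFieldNormedType.Exports.
Local Open Scope classical_set_scope.
Local Open Scope ring_scope.
Local Open Scope complex_scope.

Set Implicit Arguments.
Unset Strict Implicit.

(** * Slope of a rate of the form log2 (1 + c P) *)

Lemma ln_cvgryy (R : realType) : ln (x : R) @[x --> +oo] --> +oo.
Proof.
apply/cvgryPge => A; near=> x.
have Ax : expR A <= x by near: x; exact: nbhs_pinfty_ge.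
have x0 : 0 < x by exact: lt_le_trans (expR_gt0 A) Ax.
by rewrite -[A]expRK ler_ln ?posrE ?expR_gt0.
Unshelve. all: by end_near. Qed.

(** Factoring [1 + c * P = P * (c + P^-1)] turns the quotient into [1 + ln (c + P^-1) / ln P]. The
    numerator tends to [ln c], which is finite because [c] is positive, while [ln P] diverges. *)
Lemma log2_affine_slope (R : realType) (c : R) : 0 < c ->
  ergodic_slope (fun P => log2 (1 + c * P)) 1.
Proof.
move=> c0; rewrite /ergodic_slope.
have ln2 : ln 2 != 0 :> R by rewrite gt_eqF// ln_gt0// ltr1n.
have lnV : (ln (P : R))^-1 @[P --> +oo] --> 0.
  apply/gtr0_cvgV0; last exact: ln_cvgryy.
  by near=> x; rewrite ln_gt0.
have invy : (P : R)^-1 @[P --> +oo] --> 0.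
  by apply/gtr0_cvgV0; [near=> x|exact: cvg_id].
have lim : 1 + ln (c + P^-1) * (ln P)^-1 @[P --> +oo] --> 1 + ln (c + 0) * (0 : R).
  apply: cvgD; first exact: cvg_cst.
  apply: cvgM => //; apply: continuous_cvg.
    by apply: continuous_ln; rewrite addr0.
  by apply: cvgD => //; exact: cvg_cst.
rewrite mulr0 addr0 in lim; apply: cvg_trans lim; apply: near_eq_cvg.
near=> P; have P1 : 1 < P by near: P; exact: nbhs_pinfty_gt.
have P0 : 0 < P by exact: lt_trans P1.
have lnP : ln P != 0 by rewrite gt_eqF// ln_gt0.
have -> : 1 + c * P = P * (c + P^-1).
  by rewrite mulrDr mulfV ?gt_eqF// addrC mulrC.
rewrite /log2 lnM ?posrE// ?addr_gt0 ?invr_gt0//.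
by field; rewrite ln2 lnP.
Unshelve. all: by end_near. Qed.

(** * The closed-form rate: positivity of its constant and its slope *)

Lemma theta_gt0 (R : realType) (N M : nat) (m kappa : R) :
  (0 < N)%N -> (0 < M)%N -> 0 < m -> 0 <= kappa -> 0 < theta N M m kappa.
Proof.
move=> N0 M0 m0 k0.
have k1 : 0 < 4 * (kappa + 1) by rewrite mulr_gt0// ltr_wpDl.
(* The second moment e_phi ^ 2 + d_phi is 1 whatever the values of Gamma and
   of the Laguerre factor. *)
have ed : d_phi m kappa = 1 - e_phi m kappa ^+ 2.
  rewrite /d_phi /e_phi !exprMn sqr_sqrtr; last by rewrite divr_ge0 ?pi_ge0 ?ltW.
  have -> : (m `^ (- 2^-1)) ^+ 2 = m^-1.
    rewrite -powR_mulrn ?powR_ge0// -powRrM.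
    by rewrite mulNr mulVf// powR_inv1// ltW.
  by rewrite -!mulrA; congr (1 - _); ring.
rewrite /theta ed; set e := e_phi m kappa ^+ 2.
have e0 : 0 <= e by exact: sqr_ge0.
have pos n : (0 < n)%N -> 0 < (n%:R * e_phi m kappa) ^+ 2 + n%:R * (1 - e).
  move=> n0; rewrite exprMn -/e.
  have n1 : 1 <= n%:R :> R by rewrite ler1n.
  have : 0 <= e * (n%:R * (n%:R - 1)).
    by apply: mulr_ge0 => //; apply: mulr_ge0; lra.
  lra.
by rewrite mulr_gt0 ?pos.
Qed.

Lemma rate_up_slope (R : realType) (N M : nat)
  (eta alpha dh1 dh2 dg1 dgn beta a_n sigmaa sigma m Omega kappa : R) :
  (0 < N)%N -> (0 < M)%N -> 0 < eta -> 0 < dh1 -> 0 < dh2 -> 0 < dg1 ->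
  0 < dgn -> 0 < beta -> 0 < a_n -> 0 < sigma -> 0 < m -> 0 < Omega ->
  0 <= kappa ->
  ergodic_slope
    (rate_up N M eta alpha dh1 dh2 dg1 dgn beta a_n sigmaa sigma m Omega kappa)
    1.
Proof.
move=> N0 M0 eta0 dh10 dh20 dg10 dgn0 beta0 an0 s0 m0 O0 k0.
pose D := beta * sigmaa ^+ 2 * M%:R * Omega + sigma ^+ 2.
pose l := lambda_bar eta alpha dh1 dh2 dg1 dgn.
have D0 : 0 < D.
  rewrite ltr_wpDl ?exprn_gt0//.
  apply: mulr_ge0 (ltW O0); apply: mulr_ge0 (ler0n _ _).
  by rewrite mulr_ge0 ?sqr_ge0 ?(ltW beta0).
have l0 : 0 < l by rewrite !mulr_gt0 ?powR_gt0// invr_gt0 exprn_gt0.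
have -> : rate_up N M eta alpha dh1 dh2 dg1 dgn beta a_n sigmaa sigma m Omega
    kappa = (fun P => log2 (1 + theta N M m kappa * beta * a_n * l^-1 / D * P)).
  apply/funext => P; rewrite /rate_up -/D -/l; congr (log2 (1 + _)); ring.
apply: log2_affine_slope.
apply: divr_gt0 D0; apply: divr_gt0 l0; apply: mulr_gt0 an0.
by rewrite mulr_gt0 ?theta_gt0.
Qed.

(** * Random variables whose law has a Lebesgue density, and Gaussian integrals *)

Section LawWithDensity.
Context {d : measure_display} {T : measurableType d} {R : realType}.
Variable Pr : probability T R.
Local Notation mu := (@lebesgue_measure R).

(** The total mass of [p] is the probability of the whole space. *)
Lemma integrable_law_density (X : T -> R) (p : R -> R) :
  measurable_fun [set: R] p -> (forall x, 0 <= p x) ->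
  (forall A, measurable A ->
     Pr [set t | A (X t)] = (\int[mu]_(x in A) (p x)%:E)%E) ->
  mu.-integrable setT (EFin \o p).
Proof.
move=> mp p0 law; apply/integrableP; split; first exact/measurable_EFinP.
under eq_integral do rewrite gee0_abs ?lee_fin//.
rewrite -(law setT)//.
by rewrite [X in (Pr X < _)%E](_ : _ = setT)// probability_setT ltry.
Qed.

(** The law of [X] is absolutely continuous, so the integral of [f] against it can be computed with
    its Radon-Nikodym derivative; that derivative is then identified with [p] almost everywhere. *)
Lemma integral_law_density (X : T -> R) (p f : R -> R) :
  measurable_fun [set: T] X -> measurable_fun [set: R] p -> (forall x, 0 <= p x) ->
  measurable_fun [set: R] f -> (forall x, 0 <= f x) ->
  (forall A, measurable A ->
     Pr [set t | A (X t)] = (\int[mu]_(x in A) (p x)%:E)%E) ->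
  (\int[Pr]_t (f (X t))%:E = \int[mu]_x (f x * p x)%:E)%E.
Proof.
move=> mX mp p0 mf f0 law.
pose Xm : {mfun T >-> measurableTypeR R} :=
  HB.pack X (isMeasurableFun.Build _ _ _ (measurableTypeR R) X mX).
pose nu : probability (measurableTypeR R) R := distribution Pr Xm.
have nuE A : measurable A -> nu A = (\int[mu]_(x in A) (p x)%:E)%E.
  by move=> mA; rewrite -law.
have mpE : measurable_fun [set: measurableTypeR R] (EFin \o p).
  exact/measurable_EFinP.
have mfE : measurable_fun [set: measurableTypeR R] (EFin \o f).
  by exact/measurable_EFinP.
have dom : nu `<< mu.
  apply/null_content_dominatesP => A mA A0; rewrite [LHS]nuE//.
  by apply: null_set_integral => //; exact: measurable_funTS.
have intp := integrable_law_density mp p0 law.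
pose g : R -> \bar R := Radon_Nikodym_SigmaFinite.f nu mu.
have mg : measurable_fun [set: measurableTypeR R] g.
  exact: (measurable_int mu (Radon_Nikodym_SigmaFinite.f_integrable dom)).
(* Both functions integrate to [nu E] over every measurable [E], hence agree almost everywhere. *)
have gp : ae_eq mu setT (EFin \o p) g.
  apply: integral_ae_eq => // E _ mE.
  by rewrite -Radon_Nikodym_SigmaFinite.f_integral//; exact/esym/nuE.
transitivity (\int[nu]_x (f x)%:E)%E.
  by rewrite ge0_integral_distribution// => y; rewrite lee_fin.
rewrite -(Radon_Nikodym_SigmaFinite.change_of_variables dom)//.
apply: ge0_ae_eq_integral => //.
- by apply: emeasurable_funM.
- by apply/measurable_EFinP; exact: measurable_funM.
- move=> x _; rewrite mule_ge0 ?lee_fin//.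
  exact: Radon_Nikodym_SigmaFinite.f_ge0.
- by move=> x _; rewrite lee_fin mulr_ge0.
- apply: filterS gp => x gpx _; rewrite EFinM; congr (_ * _)%E.
  exact/esym/(gpx I).
Qed.

End LawWithDensity.

(** Half of the Gaussian exponent absorbs the power: with [y = a / 2 * x ^+ 2], the power is
    [(2 / a) ^+ n * y ^+ n], and the exponential series gives [y ^+ n <= n! * expR y]. *)
Lemma exprn_gauss_le (R : realType) (n : nat) (a x : R) : 0 < a ->
  x ^+ (2 * n) * expR (- a * x ^+ 2) <=
  (2 / a) ^+ n * n`!%:R * expR (- (a / 2) * x ^+ 2).
Proof.
move=> a0; pose y := a / 2 * x ^+ 2.
have y0 : 0 <= y by rewrite mulr_ge0 ?sqr_ge0// divr_ge0// ltW.
have -> : - a * x ^+ 2 = - y + - y by rewrite /y; field.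
have -> : x ^+ (2 * n) = (2 / a) ^+ n * y ^+ n.
  rewrite exprM -exprMn /y; congr (_ ^+ n); field.
  by rewrite gt_eqF.
rewrite mulNr -/y expRD mulrA ler_wpM2r ?expR_ge0// -!mulrA.
rewrite ler_wpM2l ?exprn_ge0 ?divr_ge0 ?(ltW a0)//.
rewrite -ler_pdivlMr ?expR_gt0// expRN invrK.
rewrite -ler_pdivrMl ?ltr0n ?fact_gt0// mulrC.
(* [expR_ge1Dxn] is applied at a positive exponent; at exponent 0 the claim reduces to
   [1 <= expR y]. *)
case: n => [|n]; first by rewrite expr0 fact0 divr1 -expR0 ler_expR.
by apply: le_trans (expR_ge1Dxn n y0); rewrite lerDr.
Qed.

Lemma integrable_gauss (R : realType) (b : R) : 0 < b ->
  (@lebesgue_measure R).-integrable setT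
    (fun x => (expR (- b * x ^+ 2))%:E).
Proof.
(* With variance [s ^+ 2 = 1 / (2 b)], the normal density is [expR (- b * x ^+ 2)] up to its peak
   value. *)
move=> b0; pose s := Num.sqrt (2 * b)^-1.
have b2 : 0 < (2 * b)^-1 by rewrite invr_gt0 mulr_gt0.
have s0 : s != 0 by rewrite gt_eqF// sqrtr_gt0.
have ns := @integrable_normal_pdf R 0 s.
have := integrableZl measurableT (normal_peak s)^-1 ns.
apply: eq_integrable => // x _.
rewrite -EFinM normal_pdfE// mulrA mulVf ?mul1r; last first.
  by rewrite gt_eqF// normal_peak_gt0.
rewrite /normal_fun subr0 sqr_sqrtr ?(ltW b2)//; congr (expR _)%:E.
by rewrite -mulr_natr; field; rewrite gt_eqF.
Qed.

(** * Even moments of the fading coefficients *)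

Section Moments.
Context {d : measure_display} {T : measurableType d} {R : realType}.
Variable Pr : probability T R.
Local Notation mu := (@lebesgue_measure R).

(** For [|x| <= 1] the integrand [x ^+ (2 * n) * p x] is at most [p x]; beyond that, the tail bound
    and [exprn_gauss_le] dominate it by a Gaussian. Bounding [p] only for [1 <= |x|] admits
    densities that blow up at 0, such as the Nakagami density with [m < 1/2]. *)
Lemma integrable_moment_law (X : T -> R) (p : R -> R) (n k : nat) (a K : R) :
  measurable_fun [set: T] X -> measurable_fun [set: R] p ->
  (forall x, 0 <= p x) ->
  (forall A, measurable A ->
     Pr [set t | A (X t)] = (\int[mu]_(x in A) (p x)%:E)%E) ->
  0 < a -> 0 <= K ->
  (forall x, 1 <= `|x| -> p x <= K * x ^+ (2 * k) * expR (- a * x ^+ 2)) ->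
  Pr.-integrable setT (fun t => (X t ^+ (2 * n))%:E).
Proof.
move=> mX mp p0 law a0 K0 pK.
have even_ge0 (j : nat) (x : R) : 0 <= x ^+ (2 * j).
  by rewrite exprM exprn_ge0 ?sqr_ge0.
pose C := (2 / a) ^+ (n + k) * (n + k)`!%:R.
have mXn : measurable_fun [set: T] (fun t => (X t ^+ (2 * n))%:E).
  by apply/measurable_EFinP; exact: measurable_funX.
apply/integrableP; split => //.
under eq_integral do rewrite gee0_abs ?lee_fin//.
rewrite (integral_law_density (f := fun x => x ^+ (2 * n)) mX mp)//.
have mf : measurable_fun [set: measurableTypeR R] (fun x => (x ^+ (2 * n) * p x)%:E).
  by apply/measurable_EFinP; apply: measurable_funM => //; exact: exprn_measurable.
suff : mu.-integrable setT (fun x => (x ^+ (2 * n) * p x)%:E).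
  move=> /integrableP[_]; under eq_integral do rewrite gee0_abs ?lee_fin ?mulr_ge0//.
  by [].
have a2 : 0 < a / 2 by rewrite divr_gt0.
(* The sum of the two dominating functions serves for both ranges of [x] at once. *)
apply: le_integrable (integrableD measurableT
  (integrable_law_density mp p0 law)
  (integrableZl measurableT (K * C) (integrable_gauss a2))) => //= x _.
rewrite lee_fin ger0_norm ?mulr_ge0//; apply: le_trans (ler_norm _).
have C0 : 0 <= K * C * expR (- (a / 2) * x ^+ 2).
  by rewrite !mulr_ge0 ?expR_ge0 ?exprn_ge0 ?divr_ge0 ?(ltW a0).
have [x1|x1] := leP `|x| 1.
  rewrite ler_wpDr// ler_piMl// -(ger0_norm (even_ge0 n x)) normrX.
  by rewrite exprn_ile1.
rewrite ler_wpDl//; apply: le_trans (ler_wpM2l (even_ge0 n x) (pK x (ltW x1))) _.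
have -> : x ^+ (2 * n) * (K * x ^+ (2 * k) * expR (- a * x ^+ 2)) =
    K * (x ^+ (2 * (n + k)) * expR (- a * x ^+ 2)).
  by rewrite mulnDr exprD; ring.
by rewrite -[leRHS]mulrA ler_wpM2l// exprn_gauss_le.
Qed.

Lemma Gamma_ge0 (x : R) : 0 <= Gamma x.
Proof. by apply: Rintegral_ge0 => t _; rewrite mulr_ge0 ?powR_ge0 ?expR_ge0. Qed.

Lemma nakagami_pdf_ge0 (m Omega x : R) : 0 <= nakagami_pdf m Omega x.
Proof.
rewrite /nakagami_pdf; case: ifP => // _.
by rewrite !mulr_ge0 ?expR_ge0 ?powR_ge0 ?invr_ge0 ?mulr_ge0 ?Gamma_ge0 ?powR_ge0.
Qed.

Lemma measurable_nakagami_pdf (m Omega : R) :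
  measurable_fun [set: R] (nakagami_pdf m Omega).
Proof.
apply: measurable_fun_ifT => //.
  exact: measurable_fun_ltr.
apply: measurable_funM; first exact: measurable_funM.
apply: measurableT_comp => //; apply: measurable_funM => //.
Qed.

Lemma measurable_cabs (X : T -> R[i]) : complex_rv X ->
  measurable_fun [set: T] (fun t => cabs (X t)).
Proof.
move=> [mRe mIm].
rewrite (_ : (fun t => _) = fun t =>
  Num.sqrt (complex.Re (X t) ^+ 2 + complex.Im (X t) ^+ 2)); last first.
  by apply/funext => t; rewrite /cabs; case: (X t).
apply: (measurableT_comp (f := @Num.sqrt R)).
  by apply: continuous_measurable_fun; apply: sqrt_continuous.
by apply: measurable_funD; exact: measurable_funX.
Qed.

Lemma nakagami_moment (m Omega : R) (X : T -> R[i]) (n : nat) :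
  0 < m -> 0 < Omega -> nakagami Pr m Omega X ->
  Pr.-integrable setT (fun t => (cabs (X t) ^+ (2 * n))%:E).
Proof.
move=> m0 O0 [mX law].
(* Since [k] exceeds [m], the factor [x^(2m-1)] of the density is at most the even integer power
   [x^(2k)] as soon as [x >= 1]. *)
pose k := Num.Def.archi_bound m.
pose K := 2 * m `^ m / (Gamma m * Omega `^ m).
have K0 : 0 <= K.
  by rewrite !mulr_ge0 ?powR_ge0 ?invr_ge0 ?mulr_ge0 ?Gamma_ge0 ?powR_ge0.
apply: (@integrable_moment_law _ _ n k (m / Omega) K
  (measurable_cabs mX) (measurable_nakagami_pdf m Omega) _ law) => //.
- by move=> x; exact: nakagami_pdf_ge0.
- by rewrite divr_gt0.
move=> x x1; rewrite /nakagami_pdf; case: ifPn => [x0|_]; last first.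
  by rewrite mulr_ge0 ?expR_ge0// mulr_ge0// exprM exprn_ge0 ?sqr_ge0.
rewrite gtr0_norm// in x1.
rewrite mulNr ler_wpM2r ?expR_ge0// ler_wpM2l//.
rewrite -powR_mulrn ?(ltW x0)//; apply: ler_powR => //.
by rewrite natrM; have := archi_boundP (ltW m0); rewrite -/k; lra.
Qed.

(** Pointwise, [X + Y] is at most twice the larger of the two, so [(X + Y) ^+ n <= 2 ^+ n * (X ^+ n
    + Y ^+ n)]. *)
Lemma integrable_powerD (X Y : T -> R) (n : nat) :
  measurable_fun [set: T] X -> measurable_fun [set: T] Y ->
  (forall t, 0 <= X t) -> (forall t, 0 <= Y t) ->
  Pr.-integrable setT (fun t => (X t ^+ n)%:E) ->
  Pr.-integrable setT (fun t => (Y t ^+ n)%:E) ->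
  Pr.-integrable setT (fun t => ((X t + Y t) ^+ n)%:E).
Proof.
move=> mX mY X0 Y0 iX iY.
apply: le_integrable (integrableZl measurableT (2 ^+ n)
  (integrableD measurableT iX iY)) => //=.
  apply/measurable_EFinP; apply: measurable_funX; exact: measurable_funD.
move=> t _; rewrite lee_fin ger0_norm ?exprn_ge0 ?addr_ge0//.
apply: le_trans (ler_norm _).
wlog XY : X Y {mX mY iX iY} X0 Y0 / X t <= Y t.
  move=> h; have [|/ltW] := leP (X t) (Y t); first exact: (h X Y).
  by rewrite [X t + _]addrC [X t ^+ n + _]addrC; exact: (h Y X).
apply: (@le_trans _ _ ((2 * Y t) ^+ n)).
  by rewrite lerXn2r ?nnegrE ?addr_ge0 ?mulr_ge0//; lra.
by rewrite exprMn ler_wpM2l ?exprn_ge0// lerDr exprn_ge0.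
Qed.

Lemma integrable_power_sum (I : finType) (X : I -> T -> R) (n : nat) :
  (0 < n)%N ->
  (forall i, measurable_fun [set: T] (X i)) ->
  (forall i t, 0 <= X i t) ->
  (forall i, Pr.-integrable setT (fun t => (X i t ^+ n)%:E)) ->
  Pr.-integrable setT (fun t => ((\sum_i X i t) ^+ n)%:E).
Proof.
move=> n0 mX X0 iX.
elim: (index_enum I) => [|i s ih].
  under eq_fun do rewrite big_nil expr0n gtn_eqF//.
  exact: integrable0.
under eq_fun do rewrite big_cons.
apply: integrable_powerD => //.
  by apply: measurable_sum => j; exact: mX.
by move=> t; exact: sumr_ge0.
Qed.

Lemma normal_moment (s : R) (X : T -> R) (n : nat) : s != 0 ->
  measurable_fun [set: T] X ->
  (forall A, measurable A -> Pr [set t | A (X t)] = normal_prob 0 s A) ->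
  Pr.-integrable setT (fun t => (X t ^+ (2 * n))%:E).
Proof.
move=> s0 mX law.
apply: (@integrable_moment_law _ _ n 0 (s ^+ 2 *+ 2)^-1 (normal_peak s)
  mX (measurable_normal_pdf 0 s) _ law).
- by move=> x; exact: normal_pdf_ge0.
- by rewrite invr_gt0 mulrn_wgt0// exprn_even_gt0.
- exact: normal_peak_ge0.
move=> x _; rewrite normal_pdfE// muln0 expr0 mulr1 /normal_fun subr0 [leLHS]mulrC.
by rewrite !mulNr [X in normal_peak s * expR (- X)]mulrC [X in _ <= X]mulrC.
Qed.

(** A marginal of the joint law: the set for the imaginary part is taken to be the whole line, of
    probability 1. *)
Lemma cn01_Re_law (w : T -> R[i]) : cn01 Pr w ->
  forall A, measurable A ->
  Pr [set t | A (complex.Re (w t))] = normal_prob 0 (Num.sqrt 2^-1) A.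
Proof.
move=> [_ law] A mA; rewrite -[RHS]mule1.
rewrite -(@probability_setT _ _ _ (normal_prob 0 (Num.sqrt 2^-1))).
by rewrite -law//; congr (Pr _); apply/seteqP; split => t //= [].
Qed.

Lemma cn01_Im_law (w : T -> R[i]) : cn01 Pr w ->
  forall A, measurable A ->
  Pr [set t | A (complex.Im (w t))] = normal_prob 0 (Num.sqrt 2^-1) A.
Proof.
move=> [_ law] A mA; rewrite -[RHS]mul1e.
rewrite -(@probability_setT _ _ _ (normal_prob 0 (Num.sqrt 2^-1))).
by rewrite -law//; congr (Pr _); apply/seteqP; split => t //= [].
Qed.

Lemma cabs_ge0 (z : R[i]) : 0 <= cabs z.
Proof. by case: z => a b; exact: sqrtr_ge0. Qed.

Lemma cabs_le (x y : R) : cabs (x +i* y) <= `|x| + `|y|.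
Proof.
rewrite /cabs /= -[leRHS]ger0_norm ?addr_ge0// -sqrtr_sqr ler_wsqrtr//.
have := mulr_ge0 (normr_ge0 x) (normr_ge0 y).
by rewrite sqrrD !real_normK ?num_real//; lra.
Qed.

Lemma rician_complex_rv (kappa : R) (X : T -> R[i]) :
  rician Pr kappa X -> complex_rv X.
Proof.
move=> [w [[mRe mIm] _] Xw]; split.
- rewrite (_ : (fun t => _) = fun t => Num.sqrt (kappa / (kappa + 1)) +
    Num.sqrt (1 / (kappa + 1)) * complex.Re (w t)); last first.
    by apply/funext => t; rewrite Xw; case: (w t) => a b /=; ring.
  by apply: measurable_funD => //; exact: measurable_funM.
- rewrite (_ : (fun t => _) = fun t =>
    Num.sqrt (1 / (kappa + 1)) * complex.Im (w t)); last first.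
    by apply/funext => t; rewrite Xw; case: (w t) => a b /=; ring.
  exact: measurable_funM.
Qed.

(** By the triangle inequality the modulus is at most [c + |s * Re w| + |s * Im w|], a constant plus
    two scaled Gaussian moduli, all with finite even moments. *)
Lemma rician_moment (kappa : R) (X : T -> R[i]) (n : nat) :
  rician Pr kappa X ->
  Pr.-integrable setT (fun t => (cabs (X t) ^+ (2 * n))%:E).
Proof.
move=> ricX; have mX := measurable_cabs (rician_complex_rv ricX).
case: ricX => w cnw Xw; have [[mRe mIm] _] := cnw.
pose c := Num.sqrt (kappa / (kappa + 1)); pose s := Num.sqrt (1 / (kappa + 1)).
have s0 : Num.sqrt 2^-1 != 0 :> R by rewrite gt_eqF// sqrtr_gt0 invr_gt0.
have iRe := normal_moment n s0 mRe (cn01_Re_law cnw).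
have iIm := normal_moment n s0 mIm (cn01_Im_law cnw).
pose g t := c + (`|s * complex.Re (w t)| + `|s * complex.Im (w t)|).
have Xg t : cabs (X t) <= g t.
  rewrite Xw /g; case: (w t) => a b.
  rewrite [X in cabs X](_ : _ = (c + s * a) +i* (s * b)); last first.
    by rewrite /c /s; apply/eqP; rewrite eq_complex /=; apply/andP; split;
      apply/eqP; ring.
  apply: le_trans (cabs_le _ _) _; rewrite /= addrA lerD2r.
  by apply: le_trans (ler_normD _ _) _; rewrite [`|c|]ger0_norm ?sqrtr_ge0.
(* The exponent being even, the absolute value disappears and [s] factors out. *)
have iN (Y : T -> R) : Pr.-integrable setT (fun t => (Y t ^+ (2 * n))%:E) ->
    Pr.-integrable setT (fun t => (`|s * Y t| ^+ (2 * n))%:E).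
  move=> /(integrableZl measurableT (s ^+ (2 * n))).
  apply: eq_integrable => // t _.
  by rewrite -EFinM -exprMn !exprM real_normK ?num_real.
have mN (Y : T -> R) : measurable_fun [set: T] Y ->
    measurable_fun [set: T] (fun t => `|s * Y t|).
  by move=> mY; apply: measurableT_comp => //; exact: measurable_funM.
have ig : Pr.-integrable setT (fun t => (g t ^+ (2 * n))%:E).
  apply: integrable_powerD => //.
  - by apply: measurable_funD; exact: mN.
  - by move=> t; exact: sqrtr_ge0.
  - exact: (finite_measure_integrable_cst Pr (c ^+ (2 * n))).
  - by apply: integrable_powerD => //; [exact: mN|exact: mN|exact: iN|exact: iN].
apply: le_integrable ig => //.
  by apply/measurable_EFinP; exact: measurable_funX.
move=> t _; have g0 := le_trans (cabs_ge0 _) (Xg t).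
rewrite /= lee_fin !ger0_norm ?exprn_ge0 ?cabs_ge0//.
by rewrite lerXn2r ?nnegrE ?cabs_ge0.
Qed.

(** * The fading coefficients are almost surely nonzero *)

Lemma law_density_point_null (X : T -> R) (p : R -> R) (a : R) :
  measurable_fun [set: R] p ->
  (forall A, measurable A ->
     Pr [set t | A (X t)] = (\int[mu]_(x in A) (p x)%:E)%E) ->
  Pr [set t | X t = a] = 0%E.
Proof.
move=> mp law; have := law [set a] (measurable_set1 a) => ->.
apply: null_set_integral => //; last exact: lebesgue_measure_set1.
by apply/measurable_EFinP; exact: measurable_funTS.
Qed.

Lemma cabs_eq0 (z : R[i]) : (cabs z == 0) = (z == 0).
Proof.
case: z => a b; rewrite /cabs /= sqrtr_eq0 eq_complex /=.
by rewrite le_eqVlt ltNge addr_ge0 ?sqr_ge0// orbF paddr_eq0 ?sqr_ge0// !sqrf_eq0.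
Qed.

(** Negligibility asks for a measurable null set covering the event; the zero set of the modulus is
    one. *)
Lemma cabs_eq0_negligible (X : T -> R[i]) : complex_rv X ->
  Pr [set t | cabs (X t) = 0] = 0%E -> Pr.-negligible [set t | X t = 0].
Proof.
move=> mX P0; exists [set t | cabs (X t) = 0]; split => //.
  rewrite -[X in measurable X]setTI.
  exact: (measurable_cabs mX measurableT (measurable_set1 0)).
by move=> t /= ->; apply/eqP; rewrite cabs_eq0.
Qed.

Lemma nakagami_neq0 (m Omega : R) (X : T -> R[i]) :
  nakagami Pr m Omega X -> Pr.-negligible [set t | X t = 0].
Proof.
move=> [mX law]; apply: cabs_eq0_negligible => //.
exact: law_density_point_null (measurable_nakagami_pdf m Omega) law.
Qed.

(** The line-of-sight component is real, so the imaginary part of [X] is a positive multiple of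
    [Im w]. Thus [X = 0] forces a Gaussian variable to vanish. *)
Lemma rician_neq0 (kappa : R) (X : T -> R[i]) : 0 <= kappa ->
  rician Pr kappa X -> Pr.-negligible [set t | X t = 0].
Proof.
move=> k0 [w cnw Xw]; have [[mRe mIm] _] := cnw.
have s0 : 0 < Num.sqrt (1 / (kappa + 1)).
  by rewrite sqrtr_gt0 divr_gt0// ltr_wpDl.
exists [set t | complex.Im (w t) = 0]; split.
- rewrite -[X in measurable X]setTI.
  exact: (mIm measurableT _ (measurable_set1 0)).
- exact: law_density_point_null (measurable_normal_pdf _ _) (cn01_Im_law cnw).
- move=> t /=; rewrite Xw; case: (w t) => a b /= [_].
  rewrite !mul0r !addr0 add0r => /eqP.
  by rewrite mulf_eq0 gt_eqF//= => /eqP.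
Qed.

End Moments.

(** The rate is [log2 (1 + E[Y] * P)], so only [E[Y] > 0] is at stake. If the mean of the
    nonnegative [Y] were 0, then [Y] would vanish almost surely; being also almost surely nonzero,
    it would make the whole space negligible. *)
Lemma jensen_rate_linear_slope (d : measure_display) (T : measurableType d)
  (R : realType) (Pr : probability T R) (X : R -> T -> R) (Y : T -> R) :
  (forall P t, X P t = P * Y t) -> (forall t, 0 <= Y t) ->
  Pr.-integrable setT (EFin \o Y) -> Pr.-negligible [set t | Y t = 0] ->
  ergodic_slope (fun P => jensen_rate Pr (X P)) 1.
Proof.
move=> XY Y0 iY Yneq0.
pose E := (\int[Pr]_t (Y t)%:E)%E.
have Efin : E \is a fin_num by exact: integrable_fin_num.
have E0 : (0 <= E)%E by apply: integral_ge0 => t _; rewrite lee_fin.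
have c0 : 0 < fine E.
  rewrite fine_gt0// ltey_eq Efin andbT lt_def E0 andbT; apply/negP => /eqP EE0.
  have mY := measurable_int Pr iY.
  have : ae_eq Pr setT (EFin \o Y) (cst 0%E).
    apply/ae_eq_integral_abs => //; rewrite -[RHS]EE0.
    by apply: eq_integral => t _; rewrite gee0_abs ?lee_fin.
  move=> /(negligibleU Yneq0) nT.
  have : Pr.-negligible [set: T].
    apply: negligibleS nT => t _.
    have [Yt|Yt] := eqVneq (Y t) 0; [by left|right => /= /(_ I) [Yt']].
    by rewrite Yt' eqxx in Yt.
  move=> /(measure_negligible measurableT) PT.
  by have /eqP := etrans (esym (probability_setT Pr)) PT; rewrite onee_eq0.
have -> : (fun P => jensen_rate Pr (X P)) = fun P => log2 (1 + fine E * P).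
  apply/funext => P; rewrite /jensen_rate unlock; congr (log2 (1 + _)).
  under eq_integral do rewrite XY EFinM.
  by rewrite integralZl// -/E -(fineK Efin) -EFinM /= mulrC.
exact: log2_affine_slope.
Qed.

(** * Channel moduli and a polynomial bound on the SINR *)

Section Channels.
Context {R : realType}.
Implicit Types (z : R[i]).

Lemma cabsM z z' : cabs (z * z') = cabs z * cabs z'.
Proof.
by rewrite /cabs normrM; case: z z' => [a b] [a' b'] /=; rewrite mulr0 subr0.
Qed.

Lemma cabs_conjc z : cabs (conjc z) = cabs z.
Proof. by case: z => a b; rewrite /cabs /= sqrrN. Qed.

Lemma cabs_real (x : R) : 0 <= x -> cabs x%:C = x.
Proof. by move=> x0; rewrite /cabs /= expr0n addr0 sqrtr_sqr ger0_norm. Qed.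

(** A diagonal unit-modulus matrix only rotates each entry of the row, so the amplified-noise gain
    does not depend on the phases. *)
Lemma sqnorm_chan_phase_shift (n : nat) (pl : R) (c : 'I_n -> R[i])
  (Phi : 'M[R[i]]_n) : 0 <= pl -> phase_shift Phi ->
  sqnorm (ctr (chan pl c) *m Phi) = pl * \sum_(j < n) cabs (c j) ^+ 2.
Proof.
move=> pl0 [/is_diag_mxP Phi_diag Phi1]; rewrite /sqnorm mulr_sumr.
apply: eq_bigr => j _; rewrite !mxE (bigD1 j)//= big1 ?addr0; last first.
  by move=> i ij; rewrite Phi_diag ?mulr0// eq_sym.
rewrite cabsM Phi1 mulr1 !mxE cabs_conjc cabsM cabs_conjc.
by rewrite cabs_real ?sqrtr_ge0// exprMn sqr_sqrtr.
Qed.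

(* Cauchy-Schwarz lets the noise amplified through gn absorb the signal factors
   of gn, so that no moment of gn is left on the right-hand side. *)
Lemma sinr_gain_le (N M : nat) (u v : 'I_N -> R) (x y : 'I_M -> R) (k s : R) :
  (forall i, 0 <= u i) -> (forall i, 0 <= v i) ->
  (forall j, 0 <= x j) -> (forall j, 0 <= y j) -> 0 < k -> 0 < s ->
  (\sum_i u i * v i) ^+ 2 * ((\sum_j x j * y j) ^+ 2 / (k * (\sum_j y j ^+ 2) + s))
  <= k^-1 * (\sum_i u i + \sum_i v i + \sum_j x j) ^+ 6.
Proof.
move=> u0 v0 x0 y0 k0 s0.
set A := \sum_i u i; set B := \sum_i v i; set C := \sum_j x j.
set D := \sum_j y j ^+ 2.
have A0 : 0 <= A by exact: sumr_ge0.
have B0 : 0 <= B by exact: sumr_ge0.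
have C0 : 0 <= C by exact: sumr_ge0.
have D0 : 0 <= D by apply: sumr_ge0 => j _; exact: sqr_ge0.
have le_sum (I : finType) (w : I -> R) i : (forall j, 0 <= w j) ->
    w i <= \sum_j w j.
  by move=> w0; rewrite (bigD1 i)//= lerDl sumr_ge0.
have uv : \sum_i u i * v i <= A * B.
  rewrite mulr_suml; apply: ler_sum => i _.
  by rewrite ler_wpM2l// le_sum.
(* Each [y j] is at most [Num.sqrt D], its square being one of the terms of [D]. *)
have xy : \sum_j x j * y j <= C * Num.sqrt D.
  rewrite mulr_suml; apply: ler_sum => j _; rewrite ler_wpM2l//.
  rewrite -(ger0_norm (y0 j)) -sqrtr_sqr ler_wsqrtr//.
  by apply: (le_sum _ (fun j => y j ^+ 2)) => i; exact: sqr_ge0.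
have den0 : 0 < k * D + s by rewrite ltr_wpDl// mulr_ge0// ltW.
(* The part [k * D] of the denominator cancels [D]. Multiplying out the denominator avoids dividing
   by [D], which may be 0. *)
have xyD : (\sum_j x j * y j) ^+ 2 / (k * D + s) <= k^-1 * C ^+ 2.
  rewrite ler_pdivrMr//; apply: (@le_trans _ _ (C ^+ 2 * D)).
    rewrite -[D in leRHS]sqr_sqrtr// -exprMn lerXn2r ?nnegrE//.
      by apply: sumr_ge0 => j _; rewrite mulr_ge0.
    by rewrite mulr_ge0 ?sqrtr_ge0.
  rewrite mulrDr (_ : k^-1 * C ^+ 2 * (k * D) = C ^+ 2 * D).
    by rewrite lerDl mulr_ge0 ?(ltW s0)// mulr_ge0 ?sqr_ge0// invr_ge0 ltW.
  by field; rewrite gt_eqF.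
have uv2 : (\sum_i u i * v i) ^+ 2 <= (A * B) ^+ 2.
  rewrite lerXn2r ?nnegrE ?mulr_ge0//.
  by apply: sumr_ge0 => i _; rewrite mulr_ge0.
apply: (@le_trans _ _ ((A * B) ^+ 2 * (k^-1 * C ^+ 2))).
  apply: ler_pM => //; first exact: sqr_ge0.
  by rewrite divr_ge0 ?sqr_ge0// ltW.
(* What remains is [(A * B * C) ^+ 2] against [(S ^+ 3) ^+ 2], where each of the three factors is at
   most the total [S]. *)
rewrite mulrCA ler_wpM2l ?invr_ge0 ?(ltW k0)// -exprMn (exprM _ 3 2).
rewrite lerXn2r ?nnegrE ?exprn_ge0 ?addr_ge0 ?mulr_ge0//.
set S := A + B + C; have S0 : 0 <= S by rewrite !addr_ge0.
rewrite (_ : S ^+ 3 = S * S * S); last by ring.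
have SA : A <= S by rewrite /S; lra.
have SB : B <= S by rewrite /S; lra.
have SC : C <= S by rewrite /S; lra.
by apply: ler_pM => //; [exact: mulr_ge0|exact: ler_pM].
Qed.

End Channels.

(** * Slope 1 for the Jensen rate of the SINR and for its closed form *)

Unset Implicit Arguments.
Set Strict Implicit.

Theorem mainTheorem12 (R : realType) (d : measure_display)
  (T : measurableType d) (Pr : probability T R) (N M : nat)
  (eta alpha dh1 dh2 dg1 dgn beta a_n a_m sigmaa sigma m Omega kappa : R)
  (h1 h2 : 'I_N -> T -> R[i]) (g1 gn : 'I_M -> T -> R[i])
  (Phip : T -> 'M[R[i]]_N) (Phia : T -> 'M[R[i]]_M)
  (N_gt0 : (0 < N)%N) (M_gt0 : (0 < M)%N)
  (eta_gt0 : 0 < eta)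
  (dh1_gt0 : 0 < dh1) (dh2_gt0 : 0 < dh2)
  (dg1_gt0 : 0 < dg1) (dgn_gt0 : 0 < dgn)
  (beta_gt1 : 1 < beta)
  (a_n_gt0 : 0 < a_n) (a_m_gt0 : 0 < a_m) (a_sum : a_n + a_m = 1)
  (sigmaa_gt0 : 0 < sigmaa) (sigma_gt0 : 0 < sigma)
  (m_gt0 : 0 < m) (Omega_gt0 : 0 < Omega) (kappa_ge0 : 0 <= kappa)
  (h1_nakagami : forall i, nakagami Pr m Omega (h1 i))
  (gn_nakagami : forall j, nakagami Pr m Omega (gn j))
  (h2_rician : forall i, rician Pr kappa (h2 i))
  (g1_rician : forall j, rician Pr kappa (g1 j))
  (indep : mutually_independent Pr (all_coefs h1 h2 g1 gn))
  (Phip_phase : forall t, phase_shift (Phip t))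
  (Phia_phase : forall t, phase_shift (Phia t)) :
  let pl := path_loss eta alpha in
  let H1 t := chan (pl dh1) (fun i => h1 i t) in
  let H2 t := chan (pl dh2) (fun i => h2 i t) in
  let G1 t := chan (pl dg1) (fun j => g1 j t) in
  let Gn t := chan (pl dgn) (fun j => gn j t) in
  let gamma Ps t :=
    sinr beta a_n sigmaa sigma (H1 t) (H2 t) (G1 t) (Gn t)
      (Phip t) (Phia t) Ps in
  (forall t, cabs (cascade (H2 t) (Phip t) (H1 t)) ^+ 2 =
     pl dh1 * pl dh2 * (\sum_(i < N) cabs (h1 i t * h2 i t)) ^+ 2) ->
  (forall t, cabs (cascade (Gn t) (Phia t) (G1 t)) ^+ 2 =
     pl dg1 * pl dgn * (\sum_(j < M) cabs (g1 j t * gn j t)) ^+ 2) ->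
  ergodic_slope (fun Ps => jensen_rate Pr (gamma Ps)) 1 /\
  ergodic_slope
    (rate_up N M eta alpha dh1 dh2 dg1 dgn beta a_n sigmaa sigma m Omega kappa)
    1.
Proof.
move=> pl H1 H2 G1 Gn gamma coh1 coh2; split; last first.
  by apply: rate_up_slope => //; exact: lt_trans beta_gt1.
have pl_gt0 dist : 0 < dist -> 0 < pl dist.
  by move=> dist0; rewrite mulr_gt0 ?powR_gt0.
have beta0 : 0 < beta by exact: lt_trans beta_gt1.
pose k := beta * sigmaa ^+ 2 * pl dgn.
have k0 : 0 < k.
  by apply: mulr_gt0 (pl_gt0 _ dgn_gt0); rewrite mulr_gt0 ?exprn_gt0.
have s0 : 0 < sigma ^+ 2 by rewrite exprn_gt0.
pose c := beta * a_n * (pl dh1 * pl dh2) * (pl dg1 * pl dgn).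
have c0 : 0 < c.
  by apply: mulr_gt0; [apply: mulr_gt0|]; rewrite mulr_gt0 ?pl_gt0.
pose U t := \sum_(i < N) cabs (h1 i t) * cabs (h2 i t).
pose V t := \sum_(j < M) cabs (g1 j t) * cabs (gn j t).
pose D t := \sum_(j < M) cabs (gn j t) ^+ 2.
(* [Y] is the SINR at unit transmit power: [c] gathers the deterministic gains of the signal, and
   [k] is the amplified-noise coefficient including the path loss of the last hop. *)
pose Y t := c * (U t ^+ 2 * (V t ^+ 2 / (k * D t + sigma ^+ 2))).
(* The coherence hypotheses replace both cascades by sums of moduli, and the phases drop out of the
   noise term, which leaves an expression linear in [P]. *)
have gammaE P t : gamma P t = P * Y t.
  rewrite /gamma /sinr coh1 coh2 sqnorm_chan_phase_shift ?(ltW (pl_gt0 _ _))//.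
  rewrite /Y /U /V /D /k /c.
  under eq_bigr do rewrite cabsM.
  under [X in _ * (pl dg1 * _ * X ^+ 2)]eq_bigr do rewrite cabsM.
  by rewrite [beta * _ * (pl dgn * _)]mulrA; ring.
have den0 t : 0 < k * D t + sigma ^+ 2.
  rewrite ltr_wpDl// mulr_ge0 ?(ltW k0)//.
  by apply: sumr_ge0 => j _; exact: sqr_ge0.
have Y0 t : 0 <= Y t.
  by rewrite mulr_ge0 ?(ltW c0)// mulr_ge0 ?sqr_ge0// divr_ge0 ?sqr_ge0// ltW.
have mh1 i := measurable_cabs (h1_nakagami i).1.
have mgn j := measurable_cabs (gn_nakagami j).1.
have mh2 i := measurable_cabs (rician_complex_rv (h2_rician i)).
have mg1 j := measurable_cabs (rician_complex_rv (g1_rician j)).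
have mU : measurable_fun [set: T] U.
  by apply: measurable_sum => i; exact: measurable_funM.
have mV : measurable_fun [set: T] V.
  by apply: measurable_sum => j; exact: measurable_funM.
have mD : measurable_fun [set: T] D.
  by apply: measurable_sum => j; exact: measurable_funX.
have mY : measurable_fun [set: T] Y.
  apply: measurable_funM => //; apply: measurable_funM.
    exact: measurable_funX.
  apply: measurable_funM; first exact: measurable_funX.
  (* The reciprocal of the positive denominator is the power with exponent -1, a measurable
     function. *)
  rewrite (_ : (fun t => _) = fun t => (k * D t + sigma ^+ 2) `^ (-1)).
    apply: (measurableT_comp (measurable_powR (-1))).
    by apply: measurable_funD => //; exact: measurable_funM.
  by apply/funext => t; rewrite powR_inv1// ltW.
apply: (jensen_rate_linear_slope gammaE Y0).
- pose S t := \sum_(i < N) cabs (h1 i t) + \sum_(i < N) cabs (h2 i t) +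
    \sum_(j < M) cabs (g1 j t).
  have sum0 n (w : 'I_n -> T -> R[i]) t : 0 <= \sum_(i < n) cabs (w i t).
    by apply: sumr_ge0 => i _; exact: cabs_ge0.
  have msum n (w : 'I_n -> T -> R[i]) :
      (forall i, measurable_fun [set: T] (fun t => cabs (w i t))) ->
      measurable_fun [set: T] (fun t => \sum_(i < n) cabs (w i t)).
    by move=> mw; exact: measurable_sum.
  (* The sixth power is the even moment [2 * 3], available for each Nakagami and Rician modulus and
     hence for their sum. *)
  have iS : Pr.-integrable setT (fun t => (S t ^+ 6)%:E).
    apply: integrable_powerD => //; [|exact: msum| | |].
    + by apply: measurable_funD; exact: msum.
    + by move=> t; rewrite addr_ge0.
    + apply: integrable_powerD => //; [exact: msum|exact: msum| |].
      * apply: integrable_power_sum => // [i t|i]; first exact: cabs_ge0.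
        exact: (nakagami_moment 3 m_gt0 Omega_gt0).
      * apply: integrable_power_sum => // [i t|i]; first exact: cabs_ge0.
        exact: (rician_moment 3 (h2_rician i)).
    + apply: integrable_power_sum => // [i t|i]; first exact: cabs_ge0.
      exact: (rician_moment 3 (g1_rician i)).
  apply: le_integrable (integrableZl measurableT (c * k^-1) iS) => //.
    exact/measurable_EFinP.
  move=> t _; rewrite /= lee_fin ger0_norm//; apply: le_trans (ler_norm _).
  rewrite -mulrA ler_wpM2l ?(ltW c0)//.
  by apply: sinr_gain_le => // i; exact: cabs_ge0.
(* One index on each surface is enough: [U] and [V] are sums of nonnegative terms, so they are
   positive once the terms at [i0] and [j0] are. Hence [Y] can vanish only where one of these four
   coefficients does. *)
- pose i0 := Ordinal N_gt0; pose j0 := Ordinal M_gt0.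
  apply: negligibleS (negligibleU
    (negligibleU (nakagami_neq0 (h1_nakagami i0))
                 (rician_neq0 kappa_ge0 (h2_rician i0)))
    (negligibleU (rician_neq0 kappa_ge0 (g1_rician j0))
                 (nakagami_neq0 (gn_nakagami j0)))) => t /= Yt0.
  apply: contrapT => /not_orP[/not_orP[h10 h20] /not_orP[g10 gn0]].
  have cabs_gt0 z : z <> 0 -> 0 < cabs z.
    by move=> z0; rewrite lt_def cabs_ge0 cabs_eq0 andbT; apply/eqP.
  have sum_gt0 n (w w' : 'I_n -> T -> R[i]) i :
      w i t <> 0 -> w' i t <> 0 ->
      0 < \sum_(i < n) cabs (w i t) * cabs (w' i t).
    move=> wi wi'; rewrite (bigD1 i)//= ltr_wpDr//.
      by apply: sumr_ge0 => l _; rewrite mulr_ge0 ?cabs_ge0.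
    by rewrite mulr_gt0 ?cabs_gt0.
  suff : 0 < Y t by rewrite Yt0 ltxx.
  have U0 : 0 < U t by exact: (sum_gt0 _ _ _ i0).
  have V0 : 0 < V t by exact: (sum_gt0 _ _ _ j0).
  by rewrite mulr_gt0// mulr_gt0 ?exprn_gt0// divr_gt0 ?exprn_gt0.
Qed.
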